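(* Let $(\lambda,\mu,\Theta)$, with $\lambda\in\mathbb{R}^L$, $\mu\in\mathbb{R}^K$, $\Theta\in\mathbf{S}^m$, be a feasible solution to the polyhedral-estimate design problem, i.e., $$\lambda\ge0,\quad\mu\ge0,\quad\Theta\succeq0,\quad\begin{bmatrix}\sum_\ell\lambda_\ell S_\ell&\tfrac12B\\ \tfrac12B^T&A^T\Theta A+\sum_k\mu_kT_k\end{bmatrix}\succeq0 .\qquad(P)$$ Then it can be augmented, by some $H\in\mathbb{R}^{m\times\nu}$, to a feasible solution $(2\lambda,\mu,H,\Theta)$ of the linear-estimate design problem $$\min_{H,\lambda',\mu',\Theta'}\left\{\phi_{\mathcal T}(\mu')+\phi_{\mathcal S}(\lambda')+\sigma^2\varkappa^2\mathrm{Tr}(\Theta'):\ \lambda'\ge0,\ \mu'\ge0,\ \begin{bmatrix}\sum_\ell\lambda'_\ell S_\ell&\tfrac12(B-H^TA)&\tfrac12H^T\\ \tfrac12(B-H^TA)^T&\sum_k\mu'_kT_k&0\\ \tfrac12H&0&\Theta'\end{bmatrix}\succeq0\right\},$$ with the corresponding objective value satisfying $$2\phi_{\mathcal S}(\lambda)+\phi_{\mathcal T}(\mu)+\sigma^2\varkappa^2\mathrm{Tr}(\Theta)\le\mathfrak{p}_\varkappa[\Theta].$$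
   Context: $A\in\mathbb{R}^{m\times n}$, $B\in\mathbb{R}^{\nu\times n}$, $\sigma>0$ and $\varkappa>0$ are given. $T_1,\dots,T_K$ are symmetric $n\times n$ matrices with $T_k\succeq0$, $\sum_kT_k\succ0$; $S_1,\dots,S_L$ are symmetric $\nu\times\nu$ matrices with $S_\ell\succeq0$, $\sum_\ell S_\ell\succ0$. $\mathcal T\subset\mathbb{R}^K_+$ and $\mathcal S\subset\mathbb{R}^L_+$ are convex compact sets with nonempty interiors which are monotone ($0\le t\le t'\in\mathcal T$ implies $t\in\mathcal T$, and similarly for $\mathcal S$). $\phi_{\mathcal G}(z)=\sup_{g\in\mathcal G}z^Tg$ is the support function of $\mathcal G$; $\mathbf{S}^m$ is the space of symmetric $m\times m$ matrices. For $\Theta\in\mathbf{S}^m$, $$\mathfrak{p}_\varkappa[\Theta]:=\min_{\lambda,\mu}\left\{2\left[\phi_{\mathcal S}(\lambda)+\phi_{\mathcal T}(\mu)+\sigma^2\varkappa^2\mathrm{Tr}(\Theta)\right]:\ (\lambda,\mu,\Theta)\text{ satisfies }(P)\right\},$$ and the polyhedral-estimate design problem is the minimization of $\mathfrak{p}_\varkappa[\Theta]$ over $\Theta$, that is, the minimization of $2[\phi_{\mathcal S}(\lambda)+\phi_{\mathcal T}(\mu)+\sigma^2\varkappa^2\mathrm{Tr}(\Theta)]$ over all $(\lambda,\mu,\Theta)$ satisfying $(P)$.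
   Formalization: The final inequality fails for non-optimal (λ,μ): scaling λ up keeps (P) but not the bound. It is proved with p_ϰ[Θ] when (λ,μ) attains that minimum (attainment is proved), and for every feasible triple with the polyhedral objective 2[φ_S(λ)+φ_T(μ)+σ²ϰ²Tr Θ] at that triple in its place. *)

(* Defs.v *)
From HB Require Import structures.
From mathcomp Require Import all_boot all_order all_algebra.
From mathcomp Require Import all_classical all_reals.
From mathcomp Require Import topology normedtype convex.

Set Implicit Arguments.
Unset Strict Implicit.
Unset Printing Implicit Defensive.

Import Order.TTheory GRing.Theory Num.Theory.
Import numFieldNormedType.Exports.

Local Open Scope classical_set_scope.
Local Open Scope ring_scope.

Definition psd (R : realType) (p : nat) (M : 'M[R]_p) : Prop :=
  M^T = M /\ forall x : 'cV[R]_p, 0 <= (x^T *m M *m x) 0 0.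

Definition pd (R : realType) (p : nat) (M : 'M[R]_p) : Prop :=
  M^T = M /\ forall x : 'cV[R]_p, x != 0 -> 0 < (x^T *m M *m x) 0 0.

(* R^p is the space of row vectors, as in [bounded_closed_compact]. *)
Definition vle (R : realType) (p : nat) (u v : 'rV[R]_p) : Prop :=
  forall i, u 0 i <= v 0 i.

Definition monotone_set (R : realType) (p : nat) (G : set 'rV[R]_p) : Prop :=
  forall t t', vle 0 t -> vle t t' -> G t' -> G t.

Definition admissible_set (R : realType) (p : nat) (G : set 'rV[R]_p) : Prop :=
  [/\ G `<=` [set t | vle 0 t], convex_set G, compact G, G° !=set0
    & monotone_set G].

(* [sup] is real-valued; the value is the support function whenever G is
   nonempty and bounded, as admissible sets are. *)
Definition support_fun (R : realType) (p : nat) (G : set 'rV[R]_p)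
    (z : 'rV[R]_p) : R :=
  sup [set (z *m g^T) 0 0 | g in G].

Definition lincomb (R : realType) (p q : nat) (v : 'rV[R]_q)
    (M : 'I_q -> 'M[R]_p) : 'M[R]_p :=
  \sum_(i < q) v 0 i *: M i.

Definition polyhedral_feasible (R : realType) (m n nu K L : nat)
    (A : 'M[R]_(m, n)) (B : 'M[R]_(nu, n))
    (T : 'I_K -> 'M[R]_n) (S : 'I_L -> 'M[R]_nu)
    (lambda : 'rV[R]_L) (mu : 'rV[R]_K) (Theta : 'M[R]_m) : Prop :=
  [/\ vle 0 lambda, vle 0 mu, psd Theta
    & psd (block_mx (lincomb lambda S)  (2^-1 *: B)
                    (2^-1 *: B^T)       (A^T *m Theta *m A + lincomb mu T))].

Definition polyhedral_obj (R : realType) (m K L : nat) (sigma kappa : R)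
    (TT : set 'rV[R]_K) (SS : set 'rV[R]_L)
    (lambda : 'rV[R]_L) (mu : 'rV[R]_K) (Theta : 'M[R]_m) : R :=
  2 * (support_fun SS lambda + support_fun TT mu
       + sigma ^+ 2 * kappa ^+ 2 * \tr Theta).

(* The minimum over (lambda, mu) at fixed Theta, taken as a real infimum
   (junk value 0 when no (lambda, mu) is feasible for Theta). *)
Definition polyhedral_min (R : realType) (m n nu K L : nat)
    (A : 'M[R]_(m, n)) (B : 'M[R]_(nu, n)) (sigma kappa : R)
    (T : 'I_K -> 'M[R]_n) (S : 'I_L -> 'M[R]_nu)
    (TT : set 'rV[R]_K) (SS : set 'rV[R]_L) (Theta : 'M[R]_m) : R :=
  inf [set polyhedral_obj sigma kappa TT SS lm.1 lm.2 Theta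
      | lm in [set lm : 'rV[R]_L * 'rV[R]_K
              | polyhedral_feasible A B T S lm.1 lm.2 Theta]].

Definition linear_feasible (R : realType) (m n nu K L : nat)
    (A : 'M[R]_(m, n)) (B : 'M[R]_(nu, n))
    (T : 'I_K -> 'M[R]_n) (S : 'I_L -> 'M[R]_nu)
    (lambda : 'rV[R]_L) (mu : 'rV[R]_K) (H : 'M[R]_(m, nu))
    (Theta : 'M[R]_m) : Prop :=
  [/\ vle 0 lambda, vle 0 mu
    & psd (block_mx
             (lincomb lambda S)
             (row_mx (2^-1 *: (B - H^T *m A)) (2^-1 *: H^T))
             (col_mx (2^-1 *: (B - H^T *m A)^T) (2^-1 *: H))
             (block_mx (lincomb mu T) 0
                       0              Theta))].

Definition linear_obj (R : realType) (m K L : nat) (sigma kappa : R)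
    (TT : set 'rV[R]_K) (SS : set 'rV[R]_L)
    (lambda : 'rV[R]_L) (mu : 'rV[R]_K) (Theta : 'M[R]_m) : R :=
  support_fun TT mu + support_fun SS lambda
  + sigma ^+ 2 * kappa ^+ 2 * \tr Theta.

(* Main.v *)
Require Import Defs.
From mathcomp Require Import all_boot all_order all_algebra.
From mathcomp Require Import all_classical all_reals.
From mathcomp Require Import topology normedtype convex.
From mathcomp Require Import derive ring lra.

(** Let [M] be the combination of the [T k] with weights [mu], [P] that of the
    [S l] with weights [lambda], and [Q = A^T Theta A + M]. If [M] and [Theta]
    were invertible, the semidefinite constraint of the polyhedral problem
    would say [P >= 1/4 B Q^-1 B^T], and the matrix [H = Theta A Q^-1 B^T]
    would give [B - H^T A = B Q^-1 M], whence
      [(B - H^T A) M^-1 (B - H^T A)^T + H^T Theta^-1 H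
         = B Q^-1 (M + A^T Theta A) Q^-1 B^T = B Q^-1 B^T <= 4 P],
    which is the Schur complement form of the constraint on the linear
    estimate. Without invertibility, positive semidefiniteness still forces
    the rows of [B] into the row space of [Q] ([psd_block_factor]), so that
    [1/2 B = Y^T Q] for some [Y]; with [2 Y] in the role of [Q^-1 B^T], the
    Schur complements become completions of squares ([exists_linear_block]).
    This proves feasibility already for [lambda], and adding the semidefinite
    matrix [P] to the upper left block yields it for [2 lambda]. The inequality
    between the objectives holds because the support function of [TT] is
    nonnegative ([TT] contains the origin by monotonicity) and the trace of
    [Theta] is nonnegative.

    The minimum defining the polyhedral risk is attained because the feasible
    set is closed and the objective is continuous and coercive on the
    nonnegative orthant: an admissible set contains a point with all
    coordinates positive ([support_admissible_coercive],
    [polyhedral_min_attained]). *)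

Import Order.TTheory GRing.Theory Num.Theory.
Import numFieldNormedType.Exports.

Local Open Scope classical_set_scope.
Local Open Scope ring_scope.

Set Implicit Arguments.
Unset Strict Implicit.
Unset Printing Implicit Defensive.

(** * Bilinear forms and semidefinite block matrices *)

Definition bil (R : realType) (p q : nat) (M : 'M[R]_(p, q))
    (x : 'cV[R]_p) (y : 'cV[R]_q) : R :=
  (x^T *m M *m y) 0 0.

Lemma bilDm (R : realType) (p q : nat) (M N : 'M[R]_(p, q)) x y :
  bil (M + N) x y = bil M x y + bil N x y.
Proof. by rewrite /bil mulmxDr mulmxDl mxE. Qed.

Lemma bilZm (R : realType) (p q : nat) a (M : 'M[R]_(p, q)) x y :
  bil (a *: M) x y = a * bil M x y.
Proof. by rewrite /bil -scalemxAr -scalemxAl mxE. Qed.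

Lemma bil0m (R : realType) (p q : nat) x y :
  bil (0 : 'M[R]_(p, q)) x y = 0.
Proof. by rewrite /bil mulmx0 mul0mx mxE. Qed.

Lemma bilDl (R : realType) (p q : nat) (M : 'M[R]_(p, q)) x x' y :
  bil M (x + x') y = bil M x y + bil M x' y.
Proof. by rewrite /bil linearD /= !mulmxDl mxE. Qed.

Lemma bilDr (R : realType) (p q : nat) (M : 'M[R]_(p, q)) x y y' :
  bil M x (y + y') = bil M x y + bil M x y'.
Proof. by rewrite /bil mulmxDr mxE. Qed.

Lemma bilZl (R : realType) (p q : nat) (M : 'M[R]_(p, q)) a x y :
  bil M (a *: x) y = a * bil M x y.
Proof. by rewrite /bil linearZ /= -!scalemxAl mxE. Qed.

Lemma bilZr (R : realType) (p q : nat) (M : 'M[R]_(p, q)) a x y :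
  bil M x (a *: y) = a * bil M x y.
Proof. by rewrite /bil -scalemxAr mxE. Qed.

Lemma bil_tr (R : realType) (p q : nat) (M : 'M[R]_(p, q)) x y :
  bil M^T y x = bil M x y.
Proof. by rewrite /bil -[x in LHS]trmxK -!trmx_mul mxE mulmxA. Qed.

(** Moving a factor of the matrix into an argument turns the completions of
    squares below into arithmetic on the values of finitely many forms. *)
Lemma bil_mull (R : realType) (p q r : nat) (N : 'M[R]_(p, r))
    (M : 'M[R]_(r, q)) x y :
  bil (N *m M) x y = bil M (N^T *m x) y.
Proof. by rewrite /bil trmx_mul trmxK !mulmxA. Qed.

Lemma bil_mulr (R : realType) (p q r : nat) (M : 'M[R]_(p, r))
    (N : 'M[R]_(r, q)) x y :
  bil (M *m N) x y = bil M x (N *m y).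
Proof. by rewrite /bil !mulmxA. Qed.

Lemma bil_block (R : realType) (p1 p2 q1 q2 : nat)
    (M : 'M[R]_(p1, q1)) (N : 'M[R]_(p1, q2))
    (P : 'M[R]_(p2, q1)) (Q : 'M[R]_(p2, q2)) x x' y y' :
  bil (block_mx M N P Q) (col_mx x x') (col_mx y y') =
  bil M x y + bil N x y' + bil P x' y + bil Q x' y'.
Proof.
rewrite /bil tr_col_mx mul_row_block mul_row_col !mulmxDl !mxE.
by rewrite [_ + _ + (_ + _)]addrACA !addrA.
Qed.

Lemma bil_row_mx (R : realType) (p q1 q2 : nat)
    (M : 'M[R]_(p, q1)) (N : 'M[R]_(p, q2)) x y y' :
  bil (row_mx M N) x (col_mx y y') = bil M x y + bil N x y'.
Proof. by rewrite /bil mul_mx_row mul_row_col mxE. Qed.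

Lemma tr_row_mxZ (R : realType) (p q r : nat) (c : R) (M : 'M[R]_(p, q))
    (N : 'M[R]_(r, p)) :
  (row_mx (c *: M) (c *: N^T))^T = col_mx (c *: M^T) (c *: N).
Proof. by rewrite tr_row_mx; congr col_mx; rewrite linearZ/= ?trmxK. Qed.

Lemma psd_blockP (R : realType) (p q : nat) (P : 'M[R]_p) (X : 'M[R]_(p, q))
    (Q : 'M[R]_q) :
  psd (block_mx P X X^T Q) <->
  [/\ P^T = P, Q^T = Q &
      forall u v, 0 <= bil P u u + 2 * bil X u v + bil Q v v].
Proof.
have E u v : bil (block_mx P X X^T Q) (col_mx u v) (col_mx u v) =
    bil P u u + 2 * bil X u v + bil Q v v.
  by rewrite bil_block bil_tr; ring.
split=> [[]|[Ps Qs h]].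
  rewrite tr_block_mx trmxK => /eq_block_mx[Ps _ _ Qs] h.
  by split=> // u v; rewrite -E; exact: h.
split=> [|x]; first by rewrite tr_block_mx trmxK Ps Qs.
by rewrite -[x]vsubmxK; rewrite -/(bil _ _ _) E; exact: h.
Qed.

Lemma psd_cross (R : realType) (p : nat) (M : 'M[R]_p) u v :
  psd M -> - bil M u u <= 2 * bil M u v + bil M v v.
Proof.
case=> Ms /(_ (u + v)); rewrite -/(bil _ _ _) !(bilDl, bilDr).
have -> : bil M v u = bil M u v by rewrite -{1}Ms bil_tr.
by lra.
Qed.

(** A vector [y] of the kernel of [Q] leaves [u^T P u + 2 t u^T X y]
    nonnegative for every real [t], which forces [u^T X y = 0]; the row space
    of [X] is therefore orthogonal to the kernel of [Q], that is, contained in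
    the row space of [Q]. This replaces the inversion of [Q]. *)
Lemma psd_block_factor (R : realType) (p q : nat) (P : 'M[R]_p)
    (X : 'M[R]_(p, q)) (Q : 'M[R]_q) :
  psd (block_mx P X X^T Q) -> exists Y : 'M[R]_(q, p), X = Y^T *m Q.
Proof.
move=> /psd_blockP[_ _ h].
suff /submxP[D ->] : (X <= Q)%MS by exists D^T; rewrite trmxK.
rewrite submxE; apply/eqP/matrixP => i j; rewrite [RHS]mxE.
set u : 'cV[R]_p := delta_mx i 0.
set y : 'cV[R]_q := cokermx Q *m delta_mx j 0.
have Qy : Q *m y = 0 by rewrite mulmxA mulmx_coker mul0mx.
have -> : (X *m cokermx Q) i j = bil X u y.
  rewrite /bil trmx_delta /y -rowE -colE [LHS]mxE [RHS]mxE.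
  by apply: eq_bigr => k _; rewrite [row _ _ _ _]mxE [col _ _ _ _]mxE.
have h2 t : 0 <= bil P u u + 2 * t * bil X u y.
  have := h u (t *: y); rewrite !bilZr bilZl.
  by rewrite [bil Q _ _]/bil -mulmxA Qy mulmx0 mxE; lra.
set a := bil P u u in h2; set b := bil X u y in h2 *.
apply/eqP; apply: contraT => b0.
(* at this [t] the affine function of [t] takes the value [-1] *)
have := h2 (- (a + 1) / (2 * b)).
have -> : 2 * (- (a + 1) / (2 * b)) * b = - (a + 1) by field.
lra.
Qed.

(** The Schur complement inequality, with [Y^T Q Y] in the role of
    [X Q^-1 X^T]. *)
Lemma psd_block_schur (R : realType) (p q : nat) (P : 'M[R]_p)
    (Y : 'M[R]_(q, p)) (Q : 'M[R]_q) :
  psd (block_mx P (Y^T *m Q) (Y^T *m Q)^T Q) ->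
  forall u, bil Q (Y *m u) (Y *m u) <= bil P u u.
Proof.
move=> /psd_blockP[_ _ h] u; have := h u (- 1 *: (Y *m u)).
by rewrite !(bil_mull, bilZl, bilZr) trmxK; lra.
Qed.

Lemma bil_lincomb (R : realType) (p q : nat) (v : 'rV[R]_q)
    (M : 'I_q -> 'M[R]_p) x y :
  bil (lincomb v M) x y = \sum_(i < q) v 0 i * bil (M i) x y.
Proof.
rewrite /lincomb; elim/big_rec2: _ => [|i a N _ <-]; first exact: bil0m.
by rewrite bilDm bilZm.
Qed.

Lemma lincomb_sym (R : realType) (p q : nat) (v : 'rV[R]_q)
    (M : 'I_q -> 'M[R]_p) :
  (forall i, psd (M i)) -> (lincomb v M)^T = lincomb v M.
Proof.
move=> Mp; rewrite /lincomb linear_sum; apply: eq_bigr => i _.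
by rewrite linearZ /=; case: (Mp i) => ->.
Qed.

Lemma psd_lincomb (R : realType) (p q : nat) (v : 'rV[R]_q)
    (M : 'I_q -> 'M[R]_p) :
  (forall i, psd (M i)) -> vle 0 v -> psd (lincomb v M).
Proof.
move=> Mp v0; split=> [|x]; first exact: lincomb_sym.
rewrite -/(bil _ _ _) bil_lincomb sumr_ge0// => i _.
by apply: mulr_ge0; [have := v0 i; rewrite mxE | exact: (Mp i).2].
Qed.

Lemma psd_trace_ge0 (R : realType) (p : nat) (M : 'M[R]_p) :
  psd M -> 0 <= \tr M.
Proof.
case=> _ h; apply: sumr_ge0 => i _; have := h (delta_mx i 0).
by rewrite trmx_delta -rowE -colE !mxE.
Qed.

(** * Support functions of compact sets *)

Section support.
Variables (R : realType) (p : nat) (G : set 'rV[R]_p).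
Hypotheses (G_compact : compact G) (G_neq0 : G !=set0).

Let dotE (z g : 'rV[R]_p) : (z *m g^T) 0 0 = \sum_i z 0 i * g 0 i.
Proof. by rewrite mxE; apply: eq_bigr => i _; rewrite mxE. Qed.

Lemma ler_mx_coord (z : 'rV[R]_p) i : `|z 0 i| <= `|z|.
Proof.
rewrite [leRHS]/Num.Def.normr/= mx_normrE.
by apply/bigmax_geP; right => /=; exists (0, i).
Qed.

(** [|z^T g|] is at most [C |z|] for all [g] in [G]: this one bound makes the
    supremum finite and the support function Lipschitz. *)
Lemma dot_bounded : exists2 C : R, 0 < C &
  forall (z : 'rV[R]_p) g, G g -> `|(z *m g^T) 0 0| <= C * `|z|.
Proof.
have [M M0 hM] : exists2 M : R, 0 < M & forall g, G g -> `|g| <= M.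
  have /ex_strict_bound_gt0[M M0 hM] := compact_bounded G_compact.
  by exists M => // g Gg; apply: ltW; exact: hM.
exists ((p%:R + 1) * M) => [|z g Gg].
  by rewrite mulr_gt0// ltr_wpDl// ler0n.
rewrite dotE (le_trans (ler_norm_sum _ _ _))//.
apply: (@le_trans _ _ (\sum_(i < p) M * `|z|)).
  apply: ler_sum => i _; rewrite normrM mulrC ler_pM// ?ler_mx_coord//.
  by rewrite (le_trans (ler_mx_coord _ _))// hM.
have Mz : 0 <= M * `|z| by rewrite mulr_ge0// ltW.
by rewrite sumr_const card_ord -mulrA mulrDl mul1r mulr_natl lerDl.
Qed.

Lemma support_ge z g : G g -> (z *m g^T) 0 0 <= support_fun G z.
Proof.
move=> Gg; apply: ub_le_sup; last by exists g.
have [C _ hC] := dot_bounded.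
by exists (C * `|z|) => _ [h Gh <-]; rewrite (le_trans (ler_norm _))// hC.
Qed.

Lemma support_le z x :
  (forall g, G g -> (z *m g^T) 0 0 <= x) -> support_fun G z <= x.
Proof.
move=> h; apply: ge_sup; last by move=> _ [g Gg <-]; exact: h.
by have [g Gg] := G_neq0; exists ((z *m g^T) 0 0), g.
Qed.

Lemma supportZ c z : 0 < c -> support_fun G (c *: z) = c * support_fun G z.
Proof.
move=> c0; apply/eqP; rewrite eq_le; apply/andP; split.
  apply: support_le => g Gg; rewrite -scalemxAl mxE ler_pM2l//.
  exact: support_ge.
rewrite -ler_pdivlMl//; apply: support_le => g Gg.
rewrite ler_pdivlMl//; have := support_ge (c *: z) Gg.
by rewrite -scalemxAl mxE.
Qed.

Lemma support_continuous : continuous (support_fun G).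
Proof.
have [C C0 hC] := dot_bounded.
have lip z z' : support_fun G z <= support_fun G z' + C * `|z - z'|.
  apply: support_le => g Gg.
  rewrite -[z in leLHS](addrNK z') addrC mulmxDl mxE lerD ?support_ge//.
  by rewrite (le_trans (ler_norm _))// hC.
move=> z; apply/(@cvgrPdist_lt _ R^o _ _ (nbhs_filter z)) => e e0.
have : nbhs z [set z' | `|z - z'| < e / C].
  by apply/nbhs_ballP; exists (e / C); rewrite /= ?divr_gt0// mx_norm_ball.
apply: filterS => z' /=; rewrite ltr_pdivlMr// mulrC => h.
rewrite (le_lt_trans _ h)// ler_distl; apply/andP; split.
  by rewrite lerBlDr distrC lip.
exact: lip.
Qed.

End support.

Lemma admissible_neq0 (R : realType) (p : nat) (G : set 'rV[R]_p) :
  admissible_set G -> G !=set0.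
Proof. by case=> _ _ _ [t /interior_subset Gt] _; exists t. Qed.

Lemma admissible_compact (R : realType) (p : nat) (G : set 'rV[R]_p) :
  admissible_set G -> compact G.
Proof. by case. Qed.

Lemma support_admissible_ge0 (R : realType) (p : nat) (G : set 'rV[R]_p) z :
  admissible_set G -> 0 <= support_fun G z.
Proof.
move=> Ga; have [Gpos _ Gc _ Gm] := Ga; have [g Gg] := admissible_neq0 Ga.
have G0 : G 0 := Gm _ _ (fun i => lexx _) (Gpos g Gg) Gg.
by have := support_ge Gc z G0; rewrite trmx0 mulmx0 mxE.
Qed.

(** An interior point can be moved by [e] in every coordinate within [G], and
    [G] lies in the nonnegative orthant, so [G] has a point with all its
    coordinates at least [e]. *)
Lemma support_admissible_coercive (R : realType) (p : nat)
    (G : set 'rV[R]_p) :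
  admissible_set G -> exists2 e : R, 0 < e &
    forall z, vle 0 z -> forall i, e * z 0 i <= support_fun G z.
Proof.
move=> [Gpos _ Gc [t it] _].
have /nbhs_ballP[e /= e0 he] : nbhs t G by exact: it.
have e20 : 0 < e / 2 by rewrite divr_gt0.
exists (e / 2) => // z z0 i.
set g : 'rV[R]_p := \row_j (t 0 j + e / 2).
have Gg : G g.
  apply: he; split=> // k j; rewrite mxE !ord1 /ball/= opprD addrA subrr sub0r.
  by rewrite normrN gtr0_norm//; lra.
have t0 j : 0 <= t 0 j by have := Gpos t (interior_subset it) j; rewrite mxE.
have {}z0 j : 0 <= z 0 j by have := z0 j; rewrite mxE.
apply: le_trans (support_ge Gc z Gg).
rewrite mxE (bigD1 i)//= !mxE [leLHS]mulrC -[leLHS]addr0 lerD//.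
  by rewrite ler_wpM2l// lerDr.
by apply: sumr_ge0 => j _; rewrite !mxE mulr_ge0// addr_ge0// ltW.
Qed.

(** * Attainment of the minimum *)

Lemma add_continuous (R : realType) (V : topologicalType) (f g : V -> R) :
  continuous f -> continuous g -> continuous (fun x => f x + g x).
Proof.
by move=> fc gc x; exact: (@continuousD _ R^o _ _ _ _ (fc x) (gc x)).
Qed.

Lemma mul_continuous (R : realType) (V : topologicalType) (f g : V -> R) :
  continuous f -> continuous g -> continuous (fun x => f x * g x).
Proof.
by move=> fc gc x; exact: (@continuousM _ _ _ _ _ (fc x) (gc x)).
Qed.

Lemma sum_continuous (R : realType) (V : topologicalType) (q : nat)
    (f : 'I_q -> V -> R) :
  (forall i, continuous (f i)) -> continuous (fun x => \sum_(i < q) f i x).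
Proof.
elim: q f => [|q IH] f fc.
  by under eq_fun do rewrite big_ord0; exact: cst_continuous.
under eq_fun do rewrite big_ord_recr/=.
apply: add_continuous; last exact: fc.
by apply: (IH (fun i => f (widen_ord (leqnSn q) i))) => i; exact: fc.
Qed.


Section polyhedral.
Variables (R : realType) (m n nu K L : nat).
Variables (A : 'M[R]_(m, n)) (B : 'M[R]_(nu, n)).
Variables (T : 'I_K -> 'M[R]_n) (S : 'I_L -> 'M[R]_nu) (Theta : 'M[R]_m).
Hypotheses (T_psd : forall k, psd (T k)) (S_psd : forall l, psd (S l)).
Hypothesis Theta_psd : psd Theta.

Lemma polyhedral_block_psdP lambda mu :
  psd (block_mx (lincomb lambda S) (2^-1 *: B)
                (2^-1 *: B^T)      (A^T *m Theta *m A + lincomb mu T)) <->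
  forall u v, 0 <= \sum_(l < L) lambda 0 l * bil (S l) u u
                   + 2 * bil (2^-1 *: B) u v
                   + (bil (A^T *m Theta *m A) v v
                      + \sum_(k < K) mu 0 k * bil (T k) v v).
Proof.
have -> : 2^-1 *: B^T = (2^-1 *: B)^T by rewrite linearZ.
split=> [/psd_blockP[_ _ h] u v|h].
  by have := h u v; rewrite bilDm !bil_lincomb.
apply/psd_blockP; split=> [||u v].
- exact: lincomb_sym.
- by rewrite linearD/= lincomb_sym// !trmx_mul trmxK Theta_psd.1 mulmxA.
- by rewrite bilDm !bil_lincomb; exact: h.
Qed.

(** Each defining condition is a weak inequality between affine functions of
    the two multiplier vectors. *)
Lemma polyhedral_feasible_closed :
  closed [set lm : 'rV[R]_L * 'rV[R]_K
         | polyhedral_feasible A B T S lm.1 lm.2 Theta].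
Proof.
pose V := ('rV[R]_L * 'rV[R]_K)%type.
have c1 i : continuous (fun lm : V => lm.1 0 i).
  move=> lm; apply: (@continuous_comp _ _ _ fst (fun z : 'rV[R]_L => z 0 i)).
    exact: cvg_fst.
  exact: coord_continuous.
have c2 i : continuous (fun lm : V => lm.2 0 i).
  move=> lm; apply: (@continuous_comp _ _ _ snd (fun z : 'rV[R]_K => z 0 i)).
    exact: cvg_snd.
  exact: coord_continuous.
pose F1 := \bigcap_(i in [set: 'I_L]) [set lm : V | 0 <= lm.1 0 i].
pose F2 := \bigcap_(i in [set: 'I_K]) [set lm : V | 0 <= lm.2 0 i].
pose F3 := \bigcap_(uv in [set: 'cV[R]_nu * 'cV[R]_n])
  [set lm : V | 0 <= \sum_(l < L) lm.1 0 l * bil (S l) uv.1 uv.1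
                   + 2 * bil (2^-1 *: B) uv.1 uv.2
                   + (bil (A^T *m Theta *m A) uv.2 uv.2
                      + \sum_(k < K) lm.2 0 k * bil (T k) uv.2 uv.2)].
have -> : [set lm : V | polyhedral_feasible A B T S lm.1 lm.2 Theta]
    = F1 `&` (F2 `&` F3).
  apply/seteqP; split=> lm /=.
    case=> l0 m0 _ /polyhedral_block_psdP h; split=> [i _|] /=.
      by have := l0 i; rewrite mxE.
    split=> [i _|[u v] _] /=; last exact: h.
    by have := m0 i; rewrite mxE.
  case=> h1 [h2 h3]; split=> // [i|i|].
  - by rewrite mxE; exact: h1.
  - by rewrite mxE; exact: h2.
  - by apply/polyhedral_block_psdP => u v; exact: (h3 (u, v)).
have ge0_closed (f : V -> R) : continuous f -> closed [set lm | 0 <= f lm].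
  by move=> /continuous_closedP/(_ _ (closed_ge (y := 0))).
apply: closedI; first by apply: closed_bigI => i _; exact: ge0_closed.
apply: closedI; first by apply: closed_bigI => i _; exact: ge0_closed.
apply: closed_bigI => -[u v] _; apply: ge0_closed => /=.
have lin q (g : 'I_q -> V -> R) (a : 'I_q -> R) :
    (forall i, continuous (g i)) ->
    continuous (fun lm : V => \sum_(i < q) g i lm * a i).
  move=> gc; apply: sum_continuous => i.
  by apply: mul_continuous; [exact: gc | exact: cst_continuous].
apply: add_continuous; apply: add_continuous;
  solve [exact: cst_continuous | exact: lin].
Qed.

(** The support functions are coercive on the nonnegative orthant, so a feasible
    point whose value does not exceed that of a given one lies in a fixed box;
    the objective is continuous and has a minimizer on the compact
    intersection of that box with the feasible set. *)
Lemma polyhedral_min_attained (sigma kappa : R) TT SS lambda mu :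
  admissible_set TT -> admissible_set SS ->
  polyhedral_feasible A B T S lambda mu Theta ->
  exists lambda0 mu0, polyhedral_feasible A B T S lambda0 mu0 Theta /\
    polyhedral_obj sigma kappa TT SS lambda0 mu0 Theta =
    polyhedral_min A B sigma kappa T S TT SS Theta.
Proof.
move=> TTa SSa feas.
pose V := ('rV[R]_L * 'rV[R]_K)%type.
pose F := [set lm : V | polyhedral_feasible A B T S lm.1 lm.2 Theta].
pose f (lm : V) := polyhedral_obj sigma kappa TT SS lm.1 lm.2 Theta.
set f0 := f (lambda, mu).
have [eS eS0 coS] := support_admissible_coercive SSa.
have [eT eT0 coT] := support_admissible_coercive TTa.
pose box q (e : R) :=
  [set z : 'rV[R]_q | forall i, `[0, f0 / e]%classic (z 0 i)].
have box_compact q e : compact (box q e).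
  apply: (@rV_compact _ _ (fun=> `[0, f0 / e]%classic)) => i.
  exact: segment_compact.
have tr0 : 0 <= sigma ^+ 2 * kappa ^+ 2 * \tr Theta.
  by rewrite mulr_ge0 ?psd_trace_ge0// mulr_ge0 ?sqr_ge0.
have F_box lm : F lm -> f lm <= f0 -> (box L eS `*` box K eT) lm.
  case=> l0 m0 _ _; rewrite /f /polyhedral_obj => le_f0.
  have := support_admissible_ge0 lm.1 SSa.
  have := support_admissible_ge0 lm.2 TTa => T0 S0.
  split=> i /=; rewrite in_itv/= ler_pdivlMr// mulrC; apply/andP; split.
  - by have := l0 i; rewrite mxE.
  - by have := coS _ l0 i; lra.
  - by have := m0 i; rewrite mxE.
  - by have := coT _ m0 i; lra.
have f_cont : continuous f.
  have sc q (G : set 'rV[R]_q) (g : V -> 'rV[R]_q) : admissible_set G ->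
      continuous g -> continuous (fun lm => support_fun G (g lm)).
    move=> Ga gc lm; apply: continuous_comp; first exact: gc.
    by apply: support_continuous;
      [exact: admissible_compact | exact: admissible_neq0].
  apply: mul_continuous; first exact: cst_continuous.
  apply: add_continuous; last exact: cst_continuous.
  by apply: add_continuous; apply: sc => // x; [exact: cvg_fst|exact: cvg_snd].
have [||c] := @compact_EVT_min V R f (F `&` (box L eS `*` box K eT)) _ _
    (continuous_subspaceT f_cont).
- by exists (lambda, mu); split=> //; exact: F_box.
- have box2_compact := compact_setX (box_compact L eS) (box_compact K eT).
  apply: (subclosed_compact _ box2_compact).
    apply: closedI; first exact: polyhedral_feasible_closed.
    by apply: compact_closed; [exact: norm_hausdorff |].
  exact: subIsetr.
rewrite inE => -[Fc _] c_min.
have c_min_F lm : F lm -> f c <= f lm.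
  move=> Flm; have [le_f0|/ltW f0_le] := leP (f lm) f0.
    by apply: c_min; rewrite inE; split=> //; exact: F_box.
  by apply: le_trans f0_le; apply: c_min; rewrite inE; split=> //; exact: F_box.
exists c.1, c.2; split=> //; apply/eqP; rewrite eq_le; apply/andP; split.
  apply: lb_le_inf; first by exists (f c), c.
  by move=> _ [lm Flm <-]; exact: c_min_F.
apply: ge_inf; last by exists c.
by exists (f c) => _ [lm Flm <-]; exact: c_min_F.
Qed.

(** * The linear estimate built from a polyhedral one *)

(** Write [Q = A^T Theta A + M]. The factorization [2^-1 B = Y^T Q] splits along
    this sum: [H = 2 Theta A Y] makes the off-diagonal blocks [Y^T M] and
    [Y^T A^T Theta], so completing the squares separately in [M] and in
    [Theta] costs exactly [Y^T Q Y], which the Schur complement inequality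
    bounds by [P]. *)
Lemma exists_linear_block (M : 'M[R]_n) (P : 'M[R]_nu) :
  psd M ->
  psd (block_mx P (2^-1 *: B) (2^-1 *: B^T) (A^T *m Theta *m A + M)) ->
  exists H : 'M[R]_(m, nu),
    psd (block_mx P (row_mx (2^-1 *: (B - H^T *m A)) (2^-1 *: H^T))
                  (col_mx (2^-1 *: (B - H^T *m A)^T) (2^-1 *: H))
                  (block_mx M 0 0 Theta)).
Proof.
set Q := _ + M => M_psd.
have -> : 2^-1 *: B^T = (2^-1 *: B)^T by rewrite linearZ.
move=> hB; have [Y EY] := psd_block_factor hB.
move: (hB); rewrite EY => /psd_block_schur hs.
have [P_sym _ _] := (psd_blockP _ _ _).1 hB.
have [Ms _] := M_psd; have [Ts _] := Theta_psd.
pose H := 2 *: (Theta *m A *m Y).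
have EH : 2^-1 *: H^T = Y^T *m A^T *m Theta.
  rewrite /H linearZ/= scalerA mulVf ?pnatr_eq0// scale1r.
  by rewrite !trmx_mul Ts mulmxA.
have EBH : 2^-1 *: (B - H^T *m A) = Y^T *m M.
  rewrite scalerBr EY scalemxAl EH /Q mulmxDr !mulmxA.
  by rewrite addrAC subrr add0r.
exists H.
rewrite -tr_row_mxZ EBH EH; apply/psd_blockP; split=> //.
  by rewrite tr_block_mx !trmx0 Ms Ts.
move=> u vw; rewrite -[vw]vsubmxK; set v := usubmx vw; set w := dsubmx vw.
rewrite bil_row_mx bil_block !bil0m.
have := hs u; rewrite bilDm (bil_mulr _ A) bil_mull trmxK.
have := psd_cross (Y *m u) v M_psd.
have := psd_cross (A *m (Y *m u)) w Theta_psd.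
rewrite !(bil_mull _ Theta) !(bil_mull _ M) trmx_mul !trmxK -!mulmxA.
by lra.
Qed.

End polyhedral.

Unset Implicit Arguments.

Theorem lemma2p1 (R : realType) (m n nu K L : nat)
    (A : 'M[R]_(m, n)) (B : 'M[R]_(nu, n)) (sigma kappa : R)
    (T : 'I_K -> 'M[R]_n) (S : 'I_L -> 'M[R]_nu)
    (TT : set 'rV[R]_K) (SS : set 'rV[R]_L)
    (sigma_gt0 : 0 < sigma) (kappa_gt0 : 0 < kappa)
    (T_psd : forall k, psd (T k)) (sumT_pd : pd (\sum_(k < K) T k))
    (S_psd : forall l, psd (S l)) (sumS_pd : pd (\sum_(l < L) S l))
    (TT_adm : admissible_set TT) (SS_adm : admissible_set SS)
    (lambda : 'rV[R]_L) (mu : 'rV[R]_K) (Theta : 'M[R]_m)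
    (feas : polyhedral_feasible A B T S lambda mu Theta) :
  let value := 2 * support_fun SS lambda + support_fun TT mu
               + sigma ^+ 2 * kappa ^+ 2 * \tr Theta in
  let pmin := polyhedral_min A B sigma kappa T S TT SS Theta in
  (exists H : 'M[R]_(m, nu),
     [/\ linear_feasible A B T S (2 *: lambda) mu H Theta,
         linear_obj sigma kappa TT SS (2 *: lambda) mu Theta = value,
         value <= polyhedral_obj sigma kappa TT SS lambda mu Theta
       & polyhedral_obj sigma kappa TT SS lambda mu Theta = pmin ->
         value <= pmin])
  /\ (exists (lambda0 : 'rV[R]_L) (mu0 : 'rV[R]_K),
        polyhedral_feasible A B T S lambda0 mu0 Theta /\
        polyhedral_obj sigma kappa TT SS lambda0 mu0 Theta = pmin).
Proof.
move=> value pmin; have [l0 m0 Theta_psd hB] := feas; split; last first.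
  exact: (polyhedral_min_attained T_psd S_psd Theta_psd _ _ TT_adm SS_adm feas).
have val_le : value <= polyhedral_obj sigma kappa TT SS lambda mu Theta.
  have := support_admissible_ge0 mu TT_adm.
  have : 0 <= sigma ^+ 2 * kappa ^+ 2 * \tr Theta.
    by rewrite mulr_ge0 ?psd_trace_ge0// mulr_ge0 ?sqr_ge0.
  by rewrite /value /polyhedral_obj; lra.
have [H hH] := exists_linear_block Theta_psd (psd_lincomb T_psd m0) hB.
exists H; split=> //; last by move=> <-.
  split=> //.
    by move=> i; rewrite !mxE mulr_ge0//; have := l0 i; rewrite mxE.
  (* the constraint with [lambda] is already met; adding the semidefinite
     block [lincomb lambda S] keeps it *)
  have -> : lincomb (2 *: lambda) S = lincomb lambda S + lincomb lambda S.
    rewrite /lincomb -big_split; apply: eq_bigr => l _ /=.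
    by rewrite mxE mulr_natl mulr2n scalerDl.
  move: hH.
  rewrite -tr_row_mxZ => /psd_blockP[Ps Qs h].
  apply/psd_blockP; split=> // [|u v].
    by rewrite linearD/= Ps.
  have := (psd_lincomb S_psd l0).2 u; rewrite -/(bil _ _ _) bilDm.
  by have := h u v; lra.
rewrite /linear_obj supportZ ?ltr0n//; first by rewrite /value; ring.
- exact: admissible_compact.
- exact: admissible_neq0.
Qed.
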